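(* For the Runge-Kutta Newton-Raphson iteration defined in the context, the truncation error $$\tau=\frac{1}{\Delta t^n}\,\tilde P(v^{n[s]},t^{n[s]})\left(\mathscr{E}(v^{n[s]},\Delta v_i^{n[s]})-v(t^{n[s]}+\Delta t^n)\right)$$ of a single sub-step is $$\tau=-\frac{\Delta t^n}{2}\,\tilde B^T(\tilde B\tilde B^T)^{-1}\tilde\alpha+O\!\left(\frac{1}{\Delta t^n}\|v_i^{n[s+1]}-v\|^3,\,(\Delta t^n)^2\right),$$ where all functions are evaluated at $v=v^{n[s]}$, $t=t^{n[s]}$, and $\tilde\alpha$ is the vector with components $$\tilde\alpha_p=\sum_j\left[\frac{\partial\tilde b_p}{\partial v_j}\frac{dv_j}{dt}-\frac{\partial\tilde B_{pj}}{\partial t}\frac{dv_j}{dt}-\sum_k\frac{\partial\tilde B_{pj}}{\partial v_k}\frac{dv_j}{dt}\frac{dv_k}{dt}\right]+\frac{\partial\tilde b_p}{\partial t}.$$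
   Context: Consider the differential-algebraic system for $v(t)\in\mathbb{R}^{\tilde M}$: $$\tilde B(v,t)\frac{dv}{dt}=\tilde b(v,t),\qquad \tilde g(v,t)=0,$$ where $\tilde B(v,t)$ is a $(\tilde M-\tilde M_A)\times\tilde M$ matrix, $\tilde b(v,t)\in\mathbb{R}^{\tilde M-\tilde M_A}$, $\tilde g(v,t)\in\mathbb{R}^{\tilde M_A}$, and $\tilde G=\partial\tilde g/\partial v$. The functions $\tilde B,\tilde b,\tilde g$ are sufficiently smooth, and the rows of $\tilde B$ and $\tilde G$ are linearly independent so that the inverse matrices below exist. Scheme. Let $\eta^{[s]}$ ($0\le s<S$) be the coefficients of a convex Euler Runge-Kutta scheme: $S=1$, $\eta^{[0]}=0$; or $S=2$, $(\eta^{[0]},\eta^{[1]})=(0,\tfrac12)$; or $S=3$, $(\eta^{[0]},\eta^{[1]},\eta^{[2]})=(0,\tfrac34,\tfrac13)$. Times of sub-steps are $t^{n[0]}=t^n$, $t^{n[s+1]}=\eta^{[s]}t^{n[0]}+(1-\eta^{[s]})(t^{n[s]}+\Delta t^n)$. Given $v^{n[0]}$ and $v^{n[s]}$ and an initial guess $\Delta v_0^{n[s]}$, set for $i\ge0$ $$v_i^{n[s+1]}=\eta^{[s]}v^{n[0]}+(1-\eta^{[s]})(v^{n[s]}+\Delta v_i^{n[s]}),\qquad \Delta v_{i+1}^{n[s]}=\mathscr{E}(v^{n[s]},\Delta v_i^{n[s]})-v^{n[s]},$$ where $$\mathscr{E}(v^{n[s]},\Delta v_i^{n[s]})=v^{n[s]}+\begin{bmatrix}\tilde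 B(v^{n[s]},t^{n[s]})\\(1-\eta^{[s]})\tilde G(v_i^{n[s+1]},t^{n[s+1]})\end{bmatrix}^{-1}\begin{bmatrix}\tilde b(v^{n[s]},t^{n[s]})\,\Delta t^n\\(1-\eta^{[s]})\tilde G(v_i^{n[s+1]},t^{n[s+1]})\Delta v_i^{n[s]}-\tilde g(v_i^{n[s+1]},t^{n[s+1]})\end{bmatrix}.$$ Here $\tilde P=\tilde B^T(\tilde B\tilde B^T)^{-1}\tilde B$ is the projection onto the row space of $\tilde B$, and $v(t)$ is the exact solution of the differential-algebraic system with $v(t^{n[s]})=v^{n[s]}$, so $dv/dt$ in $\tilde\alpha$ is the derivative of this exact solution at $t^{n[s]}$. The notation $O(a,b)$ means $O(|a|+|b|)$, as $\Delta t^n\to0$. *)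

(* Defs.v *)
From HB Require Import structures.
From mathcomp Require Import all_boot all_order all_algebra.
From mathcomp Require Import all_classical all_reals.
From mathcomp Require Import topology normedtype derive.
Set Implicit Arguments.
Unset Strict Implicit.
Unset Printing Implicit Defensive.
Import Order.TTheory GRing.Theory Num.Theory.
Import numFieldNormedType.Exports.
Local Open Scope ring_scope.
Local Open Scope classical_set_scope.

(* [f] is of class C^k on the open set [D]; on a finite-dimensional space,
   C^(k+1) amounts to: differentiable, with all directional derivatives C^k. *)
Fixpoint class_C (R : realType) (U V : normedModType R) (k : nat)
    (D : set U) (f : U -> V) : Prop :=
  match k with
  | 0 => forall x, D x -> {for x, continuous f}
  | k'.+1 => (forall x, D x -> differentiable f x) /\
             (forall u : U, class_C k' D (fun x => 'D_u f x))
  end.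

Section DAE.
Variables (R : realType) (m a : nat).

(* [m] is M - M_A and [a] is M_A, so the state space is R^(m + a). *)
Notation state := 'cV[R]_(m + a).

Definition partial_v (f : state -> R -> R) (j : 'I_(m + a)) (v : state) (t : R) : R :=
  'D_(delta_mx j 0) (fun u => f u t) v.

Definition partial_t (f : state -> R -> R) (v : state) (t : R) : R :=
  derive1 (f v) t.

Variables (B : state -> R -> 'M[R]_(m, m + a)) (b : state -> R -> 'cV[R]_m)
          (g : state -> R -> 'cV[R]_a).

Definition jac_g (v : state) (t : R) : 'M[R]_(a, m + a) :=
  \matrix_(q, j) partial_v (fun u x => g u x q 0) j v t.

(* B and b of class C^2 and g of class C^3 (hence G of class C^2) is what makes
   the exact solutions of class C^3. *)
Definition smooth_data (D : set (state * R)) : Prop :=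
  [/\ forall p j, class_C 2 D (fun x => B x.1 x.2 p j : R^o),
      forall p, class_C 2 D (fun x => b x.1 x.2 p 0 : R^o) &
      forall q, class_C 3 D (fun x => g x.1 x.2 q 0 : R^o)].

Definition independent_rows (D : set (state * R)) : Prop :=
  forall v t, D (v, t) -> row_free (col_mx (B v t) (jac_g v t)).

Definition is_solution (D : set (state * R)) (J : set R) (v : R -> state) :
    Prop :=
  forall t, J t ->
    [/\ D (v t, t), derivable v t 1,
        B (v t) t *m derive1 v t = b (v t) t & g (v t) t = 0].

Definition pinvB (v : state) (t : R) : 'M[R]_(m + a, m) :=
  (B v t)^T *m invmx (B v t *m (B v t)^T).

Definition projB (v : state) (t : R) : 'M[R]_(m + a) := pinvB v t *m B v t.

(* [w] is the velocity dv/dt at (v, t). *)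
Definition alpha (w v : state) (t : R) : 'cV[R]_m :=
  \col_p (\sum_j (partial_v (fun u x => b u x p 0) j v t * w j 0
                  - partial_t (fun u x => B u x p j) v t * w j 0
                  - \sum_k partial_v (fun u x => B u x p j) k v t * w j 0 * w k 0)
          + partial_t (fun u x => b u x p 0) v t).

(* Coefficients eta^[s] of the convex Euler scheme with S stages; only
   0 < S <= 3 and s < S are meaningful. *)
Definition rk_eta (S s : nat) : R :=
  match S, s with
  | 2, 1 => 1 / 2
  | 3, 1 => 3 / 4
  | 3, 2 => 1 / 3
  | _, _ => 0
  end.

Fixpoint subtime (S : nat) (tn h : R) (s : nat) : R :=
  match s with
  | 0 => tn
  | s'.+1 => rk_eta S s' * tn + (1 - rk_eta S s') * (subtime S tn h s' + h)
  end.

(* The sub-step from (vs, ts) to time ts', with e = eta^[s], v0 = v^{n[0]},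
   step h, and current increment d. *)
Definition vnext (e : R) (v0 vs d : state) : state :=
  e *: v0 + (1 - e) *: (vs + d).

Definition newton_mx (e : R) (v0 vs : state) (ts ts' : R) (d : state) :
    'M[R]_(m + a) :=
  col_mx (B vs ts) ((1 - e) *: jac_g (vnext e v0 vs d) ts').

Definition newton_rhs (e h : R) (v0 vs : state) (ts ts' : R) (d : state) :
    'cV[R]_(m + a) :=
  let w := vnext e v0 vs d in
  col_mx (h *: b vs ts) ((1 - e) *: (jac_g w ts' *m d) - g w ts').

Definition newton (e h : R) (v0 vs : state) (ts ts' : R) (d : state) : state :=
  vs + invmx (newton_mx e v0 vs ts ts' d) *m newton_rhs e h v0 vs ts ts' d.

Fixpoint increment (e h : R) (v0 vs : state) (ts ts' : R) (d0 : state)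
    (i : nat) : state :=
  match i with
  | 0 => d0
  | i'.+1 =>
      newton e h v0 vs ts ts' (increment e h v0 vs ts ts' d0 i') - vs
  end.

(* The iterates 0, ..., i are well defined: they stay where the data are
   defined, and the matrices to be inverted are invertible. *)
Definition well_defined_upto (D : set (state * R)) (e h : R) (v0 vs : state)
    (ts ts' : R) (d0 : state) (i : nat) : Prop :=
  forall j, (j <= i)%N ->
    let d := increment e h v0 vs ts ts' d0 j in
    D (vnext e v0 vs d, ts') /\ newton_mx e v0 vs ts ts' d \in unitmx.

Definition truncation_error (e h : R) (v0 vs : state) (ts ts' : R) (d : state)
    (v : R -> state) : state :=
  h^-1 *: (projB vs ts *m (newton e h v0 vs ts ts' d - v (ts + h))).

End DAE.

(* Main.v *)
Require Import Defs.
From HB Require Import structures.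
From mathcomp Require Import all_boot all_order all_algebra.
From mathcomp Require Import all_classical all_reals.
From mathcomp Require Import topology normedtype derive.
From mathcomp Require Import ring lra.
Set Implicit Arguments.
Unset Strict Implicit.
Unset Printing Implicit Defensive.
Import Order.TTheory GRing.Theory Num.Theory.
Import numFieldNormedType.Exports.
Local Open Scope ring_scope.
Local Open Scope classical_set_scope.

(** Write [x = (v, t)], and let [v] be the exact solution through the base point.
    The first block row of the Newton system is linear and independent of the
    iterate, so one Newton step, however inaccurate its starting point, produces an
    increment [y] with [B y = h b] exactly, the data being frozen at the base
    point ([newton_differential_rows]).  Since the projection is
    [P = B^T (B B^T)^-1 B], only [B y] enters the truncation error, which is
    therefore [- h^-1 B^T (B B^T)^-1] applied to the defect
    [B (v (s + h) - v s) - h b] of the exact solution.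

    Differentiating [B (v t, t) v' = b (v t, t)] along the solution gives
    [B v'' = alpha], so Taylor's formula makes this defect [h^2 / 2 alpha + O(h^3)];
    the first term is the announced leading error, and the rest contributes
    [O(h^2)].

    The second derivative of [v] is never formed.  The velocity solves the square
    linear system [[B; G] v' = [b; - g_t]], obtained by also differentiating
    [g (v t, t) = 0].  Its matrix is invertible, hence [v'] is bounded and
    Lipschitz ([velocity_le], [velocity_lipschitz]), with constants depending only
    on bounds of the data.  Smooth data then have a first order Taylor expansion
    with quadratic remainder along the solution ([taylor_along]), and inserting
    these expansions in the equation bounds the derivative of the defect minus
    [h^2 / 2 alpha] by a multiple of [h^2] ([defect_le]).

    Uniformity over the compact set of base points: near each point of the domain
    all the constants can be chosen locally ([near_local_bound]), a solution
    starting nearby cannot leave the neighbourhood in a short time because its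
    speed is bounded as long as it stays there ([stays_close]), and compactness
    lets one constant serve all base points. *)

(** * Sup norms and mean value bounds *)

Lemma mx_norm_le (R : realType) (m n : nat) (A : 'M[R]_(m, n)) (c : R) :
  0 <= c -> (forall i j, `|A i j| <= c) -> `|A| <= c.
Proof.
move=> c0 Ac; rewrite [leLHS]/Num.Def.normr/= mx_normrE.
by apply: (bigmax_le _ c0) => -[i j] _; exact: Ac.
Qed.

Lemma mx_coord_le (R : realType) (m n : nat) (A : 'M[R]_(m, n)) i j :
  `|A i j| <= `|A|.
Proof.
rewrite [leRHS]/Num.Def.normr/= mx_normrE.
exact: (le_bigmax _ (fun k => `|A k.1 k.2|) (i, j)).
Qed.

Lemma ler_norm_sum_const (R : realType) (T : finType) (F : T -> R) (c : R) :
  (forall i, `|F i| <= c) -> `|\sum_i F i| <= #|T|%:R * c.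
Proof.
move=> Fc; apply: le_trans (ler_norm_sum _ _ _) _.
by apply: le_trans (ler_sum _ (fun i _ => Fc i)) _; rewrite sumr_const mulr_natl.
Qed.

Lemma mx_norm_mul (R : realType) (m n p : nat) (A : 'M[R]_(m, n))
    (C : 'M[R]_(n, p)) :
  `|A *m C| <= n%:R * `|A| * `|C|.
Proof.
apply: mx_norm_le => [|i j]; first by rewrite !mulr_ge0.
rewrite mxE -mulrA -[X in X%:R]card_ord; apply: ler_norm_sum_const => k.
by rewrite normrM ler_pM // mx_coord_le.
Qed.

(** The bound is asked on the open interval only, because [stays_close] controls the
    derivative strictly before the exit time. *)
Lemma mvt_bound (R : realType) (f df : R -> R) (s t C : R) :
  s <= t -> (forall u, s <= u <= t -> is_derive u 1 f (df u)) ->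
  (forall u, s < u < t -> `|df u| <= C) -> `|f t - f s| <= C * (t - s).
Proof.
rewrite le_eqVlt => /predU1P[-> _ _|st fdf dfC].
  by rewrite !subrr normr0 mulr0.
have dfoo u : u \in `]s, t[%R -> is_derive u 1 f (df u).
  by rewrite in_itv/= => /andP[su ut]; apply: fdf; rewrite (ltW su) (ltW ut).
have fcont : {within `[s, t], continuous f}.
  apply: derivable_within_continuous => u; rewrite in_itv => us.
  have fu := fdf u us.
  exact: (@ex_derive _ _ _ _ _ _ (df u)).
have [c cst ->] := MVT st dfoo fcont.
rewrite normrM (gtr0_norm (x := t - s)) ?subr_gt0//.
by apply: ler_wpM2r; [rewrite subr_ge0 ltW|apply: dfC; rewrite in_itv in cst].
Qed.

Lemma derivable_coord (R : realType) (n : nat) (v : R -> 'cV[R]_n) t j :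
  derivable v t 1 -> is_derive t 1 (fun u => v u j 0) (derive1 v t j 0).
Proof.
move=> dv; apply: DeriveDef; first exact: ((derivable_mxP v t 1).1 dv j 0).
by rewrite derive1E derive_mx// mxE.
Qed.

Lemma mvt_bound_cV (R : realType) (n : nat) (v : R -> 'cV[R]_n) (s t C : R) :
  0 <= C -> s <= t -> (forall u, s <= u <= t -> derivable v u 1) ->
  (forall u, s < u < t -> `|derive1 v u| <= C) -> `|v t - v s| <= C * (t - s).
Proof.
move=> C0 st dv dvC.
apply: mx_norm_le => [|i j]; first by rewrite mulr_ge0 ?subr_ge0.
rewrite !mxE ord1.
apply: (mvt_bound (f := fun u => v u i 0) (df := fun u => derive1 v u i 0)) => //.
  by move=> u /dv; exact: derivable_coord.
by move=> u /dvC; apply: le_trans; exact: mx_coord_le.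
Qed.

(** A curve whose speed is at most [V] as long as it stays within [r] of its start
    needs a time [r / V] to get that far.  The bound is applied up to the first
    exit time, the infimum of the times at which the distance reaches [r]. *)
Lemma stays_close (R : realType) (n : nat) (v : R -> 'cV[R]_n) (s h V r : R) :
  0 <= V -> V * h < r ->
  (forall u, s <= u <= s + h -> derivable v u 1) ->
  (forall u, s <= u <= s + h -> `|v u - v s| < r -> `|derive1 v u| <= V) ->
  forall u, s <= u <= s + h -> `|v u - v s| < r.
Proof.
move=> V0 Vh dv dvV t1 t1h; rewrite ltNge; apply/negP => rt1.
pose E := [set u | s <= u <= s + h /\ r <= `|v u - v s|].
have Einf : has_inf E.
  by split; [exists t1|exists s => u [/andP[]]].
set t := inf E.
have st : s <= t by apply: lb_le_inf; [exists t1|move=> u [/andP[]]].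
have tE u : E u -> t <= u by move=> Eu; apply: ge_inf => //; case: Einf.
have th : t <= s + h by apply: le_trans (tE t1 _) _ => //; case/andP: t1h.
have tin : s <= t <= s + h by rewrite st th.
have before u : s <= u < t -> `|v u - v s| < r.
  move=> /andP[su ut]; rewrite ltNge; apply/negP => ru.
  suff /tE : E u by rewrite leNgt ut.
  by split=> //; rewrite su (le_trans (ltW ut)).
have vt : `|v t - v s| < r.
  apply: le_lt_trans Vh.
  apply: le_trans (ler_wpM2l V0 (_ : t - s <= h)); last by rewrite lerBlDl.
  apply: mvt_bound_cV => // u /andP[su ut].
    by apply: dv; rewrite su (le_trans ut).
  apply: dvV; first by rewrite (ltW su) (le_trans (ltW ut)).
  by apply: before; rewrite (ltW su).
have vc : {for t, continuous v}.
  by apply/differentiable_continuous/derivable1_diffP; exact: dv.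
have [d /= d0 dE] : \forall u \near t, `|v u - v s| < r.
  have : (fun u => v u - v s) u @[u --> t] --> v t - v s.
    by apply: cvgB => //; exact: cvg_cst.
  by move=> /cvgr_norm_lt /(_ _ vt).
have [e [ein re] et] := inf_adherent d0 Einf.
suff : `|v e - v s| < r by rewrite ltNge re.
apply: dE => /=; rewrite distrC ger0_norm ?subr_ge0 ?tE//.
by rewrite ltrBlDl.
Qed.

Section axes.
Variables (R : realType) (n : nat).
Implicit Types (w : 'cV[R]_n) (f : 'cV[R]_n * R -> R) (v : R -> 'cV[R]_n).

(** The basis of the extended space of pairs (state, time): [Some j] is the [j]-th
    state axis, [None] the time axis.  Treating time as one more axis lets the
    chain rule and all derivative bounds be sums over a single finite type. *)
Definition axis (o : option 'I_n) : 'cV[R]_n * R :=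
  if o is Some j then (delta_mx j 0, 0) else (0, 1).

(** Coordinates of the velocity [(w, 1)] of the curve [u |-> (v u, u)], see
    [sum_axis_speed]. *)
Definition axis_speed w (o : option 'I_n) : R := if o is Some j then w j 0 else 1.

Lemma big_option (V : nmodType) (F : option 'I_n -> V) :
  \sum_o F o = F None + \sum_j F (Some j).
Proof.
rewrite (bigD1 None)//=; congr (_ + _).
rewrite (reindex_omap Some id) /=; last by case.
by apply: eq_bigl => j; rewrite eqxx.
Qed.

Lemma sum_axis_speed w : \sum_o axis_speed w o *: axis o = (w, 1).
Proof.
have fstS : {morph (@fst 'cV[R]_n R) : x y / x + y} by case=> ? ? [].
have sndS : {morph (@snd 'cV[R]_n R) : x y / x + y} by case=> ? ? [].
rewrite big_option/=; apply/pair_equal_spec; split => /=.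
  rewrite scaler0 add0r (big_morph _ fstS (erefl _))/=.
  apply/colP => i; rewrite summxE (bigD1 i)//= big1 => [|j ji].
    by rewrite !mxE !eqxx mulr1 addr0.
  by rewrite !mxE (eq_sym i) (negbTE ji) mulr0.
rewrite (big_morph _ sndS (erefl _))/= big1 ?addr0 ?scale1r// => j _.
by rewrite scaler0.
Qed.

Lemma is_derive_along f v t :
  derivable v t 1 -> differentiable f (v t, t) ->
  is_derive t 1 (fun u => f (v u, u))
    (\sum_o axis_speed (derive1 v t) o * 'D_(axis o) f (v t, t)).
Proof.
move=> /derivable1_diffP dv df.
have did : differentiable (fun u : R => u) t by [].
have dp := differentiable_pair dv did.
have dc : differentiable (f \o (fun u => (v u, u))) t.
  exact: differentiable_comp.
apply: DeriveDef; first exact/derivable1_diffP.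
rewrite deriveE// diff_comp//= diff_pair//=.
have -> : 'd v t 1 = derive1 v t by rewrite derive1E deriveE.
have -> : 'd (fun u : R => u) t 1 = 1 by rewrite -deriveE// derive_id.
rewrite -sum_axis_speed linear_sum; apply: eq_bigr => o _.
by rewrite linearZ deriveE.
Qed.
End axes.
Arguments axis {R n} o.

(** * Functions with bounded derivatives along a curve *)

Section tame.
Variables (R : realType) (n : nat).
Local Notation X := ('cV[R]_n * R)%type.
Implicit Types (f : X -> R) (v : R -> 'cV[R]_n).

(** The pointwise, quantitative form of [class_C]: a single number [M] stands for
    the smoothness of a function, so that the constants of the estimates can be
    chosen before the solution is. *)
Fixpoint tame (k : nat) (M : R) f (x : X) : Prop :=
  `|f x| <= M /\
  if k is k'.+1
  then differentiable f x /\ forall o, tame k' M ('D_(axis o) f) x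
  else True.

Lemma tame_pred k M f x : tame k.+1 M f x -> tame k M f x.
Proof.
elim: k f => [|k IH] f [fM [df dfM]]; split => //; split=> // o.
exact/IH/dfM.
Qed.

(** A continuous function is bounded near each point, and there are finitely many
    partial derivatives of order at most [k]. *)
Lemma near_tame (D : set X) k (f : X -> R^o) x0 :
  open D -> class_C k D f -> D x0 ->
  \forall M \near +oo, \forall x \near x0, tame k M f x.
Proof.
move=> oD fC Dx0.
have near_le (f' : X -> R) : {for x0, continuous f'} ->
    \forall M \near +oo, \forall x \near x0, `|f' x| <= M.
  move=> f'c; near=> M.
  have f'M : `|f' x0| < M by near: M; apply: nbhs_pinfty_gt; rewrite num_real.
  near=> x; apply: ltW; near: x.
  exact: (@cvgr_norm_lt _ _ _ _ _ _ _ f'c M f'M).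
elim: k f fC => [|k IH] f /=.
  move=> fc; near=> M.
  have fM : \forall x \near x0, `|f x| <= M by near: M; apply: near_le; exact: fc.
  by near=> x; split=> //; near: x.
move=> [df dfC].
have IHo : \forall M \near +oo, forall o,
    \forall x \near x0, tame k M ('D_(axis o) f) x.
  by apply: filter_forall => o; apply: IH; exact: dfC.
near=> M.
have fM : \forall x \near x0, `|f x| <= M.
  near: M; apply: near_le; exact/differentiable_continuous/df.
have dfM : \forall x \near x0, forall o, tame k M ('D_(axis o) f) x.
  by apply: (filter_forall (nbhs_filter x0)); near: M.
have ndf : \forall x \near x0, differentiable f x.
  exact: (@filterS _ _ (nbhs_filter x0) _ _ df (open_nbhs_nbhs (conj oD Dx0))).
near=> x; split; [|split].
- by near: x.
- by near: x.
- by near: x.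
Unshelve. all: by end_near. Qed.

(** The derivative of [f] along a curve through [x] with velocity [w], see
    [is_derive_along]. *)
Definition rate f (w : 'cV[R]_n) (x : X) : R :=
  \sum_o axis_speed w o * 'D_(axis o) f x.

Lemma axis_speed_le w c o : 1 <= c -> `|w| <= c -> `|axis_speed (w : 'cV[R]_n) o| <= c.
Proof.
case: o => [j|] c1 wc /=; last by rewrite normr1.
by apply: le_trans wc; exact: mx_coord_le.
Qed.

Lemma ler_norm_sum_axis (F : option 'I_n -> R) (c : R) :
  (forall o, `|F o| <= c) -> `|\sum_o F o| <= n.+1%:R * c.
Proof.
by have -> : n.+1 = #|{: option 'I_n}|;
  [rewrite card_option card_ord|exact: ler_norm_sum_const].
Qed.

Section along.
Variables (v : R -> 'cV[R]_n) (s h V M : R).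
Hypotheses (V1 : 1 <= V) (M0 : 0 <= M).
Hypothesis dv : forall u, s <= u <= s + h -> derivable v u 1.
Hypothesis dvV : forall u, s <= u <= s + h -> `|derive1 v u| <= V.

Let sub t u : t <= s + h -> s <= u <= t -> s <= u <= s + h.
Proof. by move=> tsh /andP[-> ut]; rewrite (le_trans ut). Qed.

(** Bounds [rate] when the velocity is at most [V] and the partial derivatives at
    most [M]; the extended space has [n + 1] axes. *)
Definition rate_bound : R := n.+1%:R * (V * M).

Lemma rate_bound_ge0 : 0 <= rate_bound.
Proof. by rewrite !mulr_ge0// (le_trans ler01). Qed.

Lemma lipschitz_along f t :
  (forall u, s <= u <= s + h -> tame 1 M f (v u, u)) -> s <= t <= s + h ->
  `|f (v t, t) - f (v s, s)| <= rate_bound * (t - s).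
Proof.
move=> fM /andP[st tsh].
apply: (mvt_bound (f := fun u => f (v u, u))
                  (df := fun u => rate f (derive1 v u) (v u, u))) => // u.
  move=> /(sub tsh) ush; apply: is_derive_along; first exact: dv.
  by have [_ []] := fM u ush.
move=> /andP[/ltW su /ltW ut]; have ush : s <= u <= s + h.
  by apply: (sub tsh); rewrite su.
apply: ler_norm_sum_axis => o; have [_ [_ dM]] := fM u ush.
by rewrite normrM ler_pM// ?axis_speed_le ?dvV//; have [] := dM o.
Qed.

Variable L : R.
Hypothesis L0 : 0 <= L.
Hypothesis dvL : forall u, s <= u <= s + h ->
  `|derive1 v u - derive1 v s| <= L * (u - s).

(** The derivative of [u |-> f (v u, u)] is a sum of products of speeds and partial
    derivatives of [f].  Both factors are bounded and Lipschitz at [s], so this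
    derivative differs from its value at [s] by [O(t - s)]; integrate. *)
Lemma taylor_along f t :
  (forall u, s <= u <= s + h -> tame 2 M f (v u, u)) -> s <= t <= s + h ->
  `|f (v t, t) - f (v s, s) - (t - s) * rate f (derive1 v s) (v s, s)|
    <= n.+1%:R * (L * M + V * rate_bound) * (t - s) ^+ 2.
Proof.
move=> fM /andP[st tsh].
have ssh : s <= s <= s + h by rewrite lexx (le_trans st).
set r := rate _ _ _.
pose F : R -> R := (fun u => f (v u, u)) - r \*: id.
have -> : f (v t, t) - f (v s, s) - (t - s) * r = F t - F s.
  by rewrite /F !fctE /= /GRing.scale/=; ring.
rewrite expr2 mulrA.
apply: (mvt_bound (df := fun u => rate f (derive1 v u) (v u, u) - r)) => // u.
  move=> /(sub tsh) ush.
  have : is_derive u 1 (fun u => f (v u, u)) (rate f (derive1 v u) (v u, u)).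
    apply: is_derive_along; first exact: dv.
    by have [_ []] := fM u ush.
  move=> df; rewrite -[X in _ - X]mulr1; exact: is_deriveB.
move=> /andP[/ltW su /ltW ut]; have ush : s <= u <= s + h.
  by apply: (sub tsh); rewrite su.
have us0 : 0 <= u - s by rewrite subr_ge0.
have V0 : 0 <= V by exact: le_trans V1.
apply: (@le_trans _ _ (n.+1%:R * (L * M + V * rate_bound) * (u - s))); last first.
  by rewrite ler_wpM2l ?lerD2r// mulr_ge0// addr_ge0 ?mulr_ge0 ?rate_bound_ge0.
rewrite -mulrA /r /rate -sumrB; apply: ler_norm_sum_axis => o.
have [_ [_ /(_ o) dM]] := fM u ush.
have -> : forall a b c d : R, a * b - c * d = (a - c) * b + c * (b - d).
  by move=> *; ring.
apply: le_trans (ler_normD _ _) _; rewrite [leRHS]mulrDl !normrM; apply: lerD.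
  rewrite mulrAC ler_pM//; last by case: dM.
  case: o {dM} => [j|]; last by rewrite /= subrr normr0 mulr_ge0.
  apply: le_trans (dvL ush).
  by have := mx_coord_le (derive1 v u - derive1 v s) j 0; rewrite !mxE.
rewrite -mulrA ler_pM// ?axis_speed_le ?dvV//.
apply: (@lipschitz_along ('D_(axis o) f) u _ ush) => u' u'sh.
have [_ [_ /(_ o) dM']] := fM u' u'sh; exact: dM'.
Qed.

End along.
End tame.

(** Invertibility is stable with uniform control: if [N] inverts [A x0], then
    [u = N (A x u - (A x - A x0) u)], and near [x0] the last term contributes at
    most half of the norm of [u]. *)
Lemma near_unitmx_bound (R : realType) (T : topologicalType) (n : nat)
    (A : T -> 'M[R]_n) (x0 : T) :
  (forall i j, {for x0, continuous (fun x => A x i j)}) -> A x0 \in unitmx ->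
  \forall K \near +oo, \forall x \near x0, forall u : 'cV[R]_n,
    `|u| <= K * `|A x *m u|.
Proof.
move=> Ac Au; set N := invmx (A x0).
pose c : R := n%:R * `|N|.
have c0 : 0 <= c by rewrite mulr_ge0.
(* Makes [c * n * e <= 1 / 2]; the [+ 1] keeps the denominator positive. *)
pose e : R := (2 * (c * n%:R + 1))^-1.
have cn0 : 0 < c * n%:R + 1 by rewrite ltr_wpDl // mulr_ge0.
have e0 : 0 < e by rewrite invr_gt0 mulr_gt0.
near=> K; near=> x; move=> u.
have AxA0 : `|A x - A x0| <= e.
  apply: mx_norm_le; first exact: ltW.
  move=> i j; rewrite !mxE; move: i j; near: x.
  apply: filter_forall => i; apply: filter_forall => j.
  have := Ac i j => /cvgrPdist_le /(_ e e0).
  by apply: filterS => x; rewrite distrC.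
have uE : u = N *m (A x *m u - (A x - A x0) *m u).
  by rewrite mulmxBl opprB addrC subrK mulmxA mulVmx// mul1mx.
have u_le : `|u| <= c * (`|A x *m u| + n%:R * e * `|u|).
  rewrite {1}uE; apply: le_trans (mx_norm_mul _ _) _; apply: ler_wpM2l => //.
  apply: le_trans (ler_normB _ _) _; rewrite lerD2l.
  apply: le_trans (mx_norm_mul _ _) _.
  by rewrite ler_wpM2r// ler_wpM2l.
have cne : c * (n%:R * e) <= 2^-1.
  by rewrite /e mulrA ler_pdivrMr ?mulr_gt0// mulKf ?pnatr_eq0// lerDl.
have cne' : c * (n%:R * e) * `|u| <= 2^-1 * `|u| by rewrite ler_wpM2r.
have : `|u| <= 2 * c * `|A x *m u| by lra.
by move=> /le_trans; apply; apply: ler_wpM2r.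
Unshelve. all: by end_near. Qed.

(** * The linear system for the velocity *)

(** If [u A A^T = 0] then [u A] has zero sum of squares. *)
Lemma unitmx_mul_tr (R : realType) (m n : nat) (A : 'M[R]_(m, n)) :
  row_free A -> A *m A^T \in unitmx.
Proof.
move=> Afree; rewrite -row_free_unit -kermx_eq0; apply/eqP/row_matrixP => i.
rewrite row0; set u := row i _.
have uA : u *m A *m (u *m A)^T = 0.
  by rewrite trmx_mul mulmxA -(mulmxA u) -row_mul mulmx_ker row0 mul0mx.
have {}uA : u *m A = 0.
  apply/rowP => j; rewrite [RHS]mxE; apply/eqP.
  move/matrixP/(_ 0 0): uA; rewrite [LHS]mxE [RHS]mxE => uA.
  have := uA; under eq_bigr do rewrite [X in _ * X]mxE -expr2.
  move=> /eqP; rewrite psumr_eq0 => [/allP/(_ j)|k _]; last exact: sqr_ge0.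
  by rewrite mem_index_enum /= sqrf_eq0 => /(_ isT).
by apply: (row_free_inj Afree); rewrite uA mul0mx.
Qed.

Lemma row_free_gram_unit (R : realType) (m n k : nat) (A : 'M[R]_(m, n))
    (C : 'M[R]_(k, n)) : row_free (col_mx A C) -> A *m A^T \in unitmx.
Proof.
move=> /row_freeP[E]; rewrite -[E]hsubmxK mul_col_row scalar_mx_block.
by move=> /eq_block_mx[AE _ _ _]; apply: unitmx_mul_tr; apply/row_freeP;
  eexists; exact: AE.
Qed.

Section partials.
Variables (R : realType) (m a : nat) (f : 'cV[R]_(m + a) -> R -> R).

Lemma partial_vE j v t :
  partial_v f j v t = 'D_(axis (Some j)) (fun x => f x.1 x.2) (v, t).
Proof.
have E (k : R) : k^-1 *: (f (k *: delta_mx j 0 + v) t - f v t) =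
    k^-1 *: (f (k *: axis (Some j) + (v, t)).1
               (k *: axis (Some j) + (v, t)).2 - f v t).
  by rewrite /= scaler0 add0r.
exact: (congr1 (fun F : R -> R => lim (F @ 0^')) (funext E)).
Qed.

Lemma partial_tE v t :
  partial_t f v t = 'D_(axis None) (fun x => f x.1 x.2) (v, t).
Proof.
have E (k : R) : k^-1 *: (f v (k + t) - f v t) =
    k^-1 *: (f (k *: (axis None : 'cV[R]_(m + a) * R) + (v, t)).1
               (k *: (axis None : 'cV[R]_(m + a) * R) + (v, t)).2 - f v t).
  by rewrite /= scaler0 add0r [_%:A]mulr1.
exact: (congr1 (fun F : R -> R => lim (F @ 0^')) (funext E)).
Qed.

End partials.

Section dae.
Variables (R : realType) (m a : nat).
Local Notation X := ('cV[R]_(m + a) * R)%type.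
Variables (B : 'cV[R]_(m + a) -> R -> 'M[R]_(m, m + a))
          (b : 'cV[R]_(m + a) -> R -> 'cV[R]_m)
          (g : 'cV[R]_(m + a) -> R -> 'cV[R]_a).

(** Along a solution, [velocity_mx *m v' = velocity_rhs]: the upper block is the
    differential equation, the lower one is the time derivative of the
    constraint; see [solution_velocity]. *)
Definition velocity_mx (x : X) : 'M[R]_(m + a) :=
  col_mx (B x.1 x.2) (jac_g g x.1 x.2).

Definition velocity_rhs (x : X) : 'cV[R]_(m + a) :=
  col_mx (b x.1 x.2)
         (\col_q - 'D_(axis None) (fun y => g y.1 y.2 q 0 : R) x).

Lemma jac_gE q j x :
  jac_g g x.1 x.2 q j = 'D_(axis (Some j)) (fun y => g y.1 y.2 q 0) x.
Proof. by rewrite mxE partial_vE; case: x. Qed.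

(** [alpha] is the derivative of [b] minus the derivative of [B] times the velocity,
    that is the value of [B v''] forced by the differential equation. *)
Lemma alphaE w v t p :
  alpha B b w v t p 0 = rate (fun x => b x.1 x.2 p 0) w (v, t)
    - \sum_j rate (fun x => B x.1 x.2 p j) w (v, t) * w j 0.
Proof.
rewrite mxE partial_tE /rate big_option /= mul1r [LHS]addrC -[RHS]addrA; congr (_ + _).
rewrite -sumrB; apply: eq_bigr => j _; rewrite partial_vE partial_tE big_option/=.
rewrite mul1r mulrC mulrDl -addrA -opprD; congr (_ - (_ + _)).
rewrite mulr_suml; apply: eq_bigr => k _; rewrite partial_vE.
by rewrite mulrAC [X in X * _]mulrC.
Qed.

Definition tame_data (M : R) (x : X) : Prop :=
  [/\ forall p j, tame 2 M (fun y => B y.1 y.2 p j) x,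
      forall p, tame 2 M (fun y => b y.1 y.2 p 0) x &
      forall q, tame 3 M (fun y => g y.1 y.2 q 0) x].

Lemma tame_velocity_mx M x i j : tame_data M x ->
  tame 1 M (fun y => velocity_mx y i j) x.
Proof.
move=> [BM _ gM]; case: (split_ordP i) => [p ->|q ->].
  have -> : (fun y => velocity_mx y (lshift a p) j) = fun y => B y.1 y.2 p j.
    by apply/funext => y; rewrite col_mxEu.
  exact/tame_pred/BM.
have -> : (fun y => velocity_mx y (rshift m q) j) =
    'D_(axis (Some j)) (fun y => g y.1 y.2 q 0).
  by apply/funext => y; rewrite col_mxEd jac_gE.
by have [_ [_ dM]] := gM q; exact/tame_pred/dM.
Qed.

Lemma solution_velocity (D : set X) (M t1 t2 : R) v t :
  is_solution B b g D `]t1, t2[ v -> t1 < t < t2 -> tame_data M (v t, t) ->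
  velocity_mx (v t, t) *m derive1 v t = velocity_rhs (v t, t).
Proof.
move=> sol tin [_ _ gM].
have tin' : `]t1, t2[ t by rewrite /= in_itv.
have [_ dv Bv gv] := sol t tin'.
rewrite mul_col_mx Bv; congr col_mx.
apply/colP => q; rewrite !mxE; apply/eqP; rewrite -addr_eq0; apply/eqP.
have dg : differentiable (fun y => g y.1 y.2 q 0) (v t, t).
  by case: (gM q) => _ [].
have H := is_derive_along dv dg.
transitivity (\sum_o axis_speed (derive1 v t) o *
              'D_(axis o) (fun y => g y.1 y.2 q 0) (v t, t)).
  rewrite big_option/= mul1r addrC; congr (_ + _).
  by apply: eq_bigr => j _; rewrite mxE partial_vE mulrC.
rewrite -(@derive_val _ _ _ _ _ _ _ H).
(* The constraint vanishes on a whole neighbourhood of [t], so its derivative is 0. *)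
have -> : 'D_1 (fun u => g (v u) u q 0) t = 'D_1 (cst 0) t.
  apply: near_eq_derive.
  have nJ : \forall u \near t, u \in `]t1, t2[%R.
    by apply: near_in_itvoo; rewrite inE.
  near=> u; have uJ : `]t1, t2[ u by near: u.
  by have [_ _ _ ->] := sol u uJ; rewrite mxE.
exact: derive_cst.
Unshelve. all: by end_near. Qed.

(** Everything the estimates use about the data at [x]: bounds on the derivatives,
    and on the inverses of the two matrices that have to be inverted. *)
Definition local_bound (M : R) (x : X) : Prop :=
  [/\ tame_data M x,
      forall w : 'cV[R]_(m + a), `|w| <= M * `|velocity_mx x *m w| &
      forall y : 'cV[R]_m,
        `|y| <= M * `|B x.1 x.2 *m (B x.1 x.2)^T *m y|].

Lemma near_local_bound (D : set X) x0 :
  open D -> smooth_data B b g D -> independent_rows B g D -> D x0 ->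
  \forall M \near +oo, \forall x \near x0, local_bound M x.
Proof.
move=> oD [B2 b2 g3] rowsD Dx0.
have nBp p : \forall M \near +oo, forall j,
    \forall x \near x0, tame 2 M (fun y => B y.1 y.2 p j) x.
  by apply: filter_forall => j; apply: near_tame (B2 p j) Dx0.
have nB : \forall M \near +oo, forall p j,
    \forall x \near x0, tame 2 M (fun y => B y.1 y.2 p j) x.
  exact: filter_forall.
have nb : \forall M \near +oo, forall p,
    \forall x \near x0, tame 2 M (fun y => b y.1 y.2 p 0) x.
  by apply: filter_forall => p; apply: near_tame (b2 p) Dx0.
have ng : \forall M \near +oo, forall q,
    \forall x \near x0, tame 3 M (fun y => g y.1 y.2 q 0) x.
  by apply: filter_forall => q; apply: near_tame (g3 q) Dx0.
have dB p j : differentiable (fun x => B x.1 x.2 p j) x0.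
  by case: (B2 p j) => /(_ _ Dx0).
have nV : \forall M \near +oo, \forall x \near x0, forall w : 'cV[R]_(m + a),
    `|w| <= M * `|velocity_mx x *m w|.
  apply: near_unitmx_bound; last first.
    rewrite -row_free_unit; apply: rowsD.
    by rewrite -surjective_pairing.
  move=> i j; case: (split_ordP i) => [p ->|q ->].
    have -> : (fun y => velocity_mx y (lshift a p) j) = fun y => B y.1 y.2 p j.
      by apply/funext => y; rewrite col_mxEu.
    exact/differentiable_continuous/dB.
  have -> : (fun y => velocity_mx y (rshift m q) j) =
      'D_(axis (Some j)) (fun y => g y.1 y.2 q 0).
    by apply/funext => y; rewrite col_mxEd jac_gE.
  have [_ /(_ (axis (Some j))) [/(_ _ Dx0) dg _]] := g3 q.
  exact/differentiable_continuous/dg.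
have nBB : \forall M \near +oo, \forall x \near x0, forall y : 'cV[R]_m,
    `|y| <= M * `|B x.1 x.2 *m (B x.1 x.2)^T *m y|.
  apply: (near_unitmx_bound (A := fun x => B x.1 x.2 *m (B x.1 x.2)^T)).
    move=> p q; apply: differentiable_continuous.
    have -> : (fun x : X => (B x.1 x.2 *m (B x.1 x.2)^T) p q) =
        \sum_(k < m + a) ((fun x : X => B x.1 x.2 p k) * (fun x : X => B x.1 x.2 q k)).
      apply/funext => x; rewrite mxE fct_sumE; apply: eq_bigr => k _.
      by rewrite mxE.
    by apply: differentiable_sum => k; apply: differentiableM; exact: dB.
  by apply: row_free_gram_unit; apply: rowsD; rewrite -surjective_pairing.
near=> M.
have xB : \forall x \near x0, forall p j, tame 2 M (fun y => B y.1 y.2 p j) x.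
  apply: (filter_forall (nbhs_filter x0)) => p.
  apply: (filter_forall (nbhs_filter x0)) => j; move: p j; near: M.
  exact: nB.
have xb : \forall x \near x0, forall p, tame 2 M (fun y => b y.1 y.2 p 0) x.
  by apply: (filter_forall (nbhs_filter x0)); near: M.
have xg : \forall x \near x0, forall q, tame 3 M (fun y => g y.1 y.2 q 0) x.
  by apply: (filter_forall (nbhs_filter x0)); near: M.
have xV : \forall x \near x0, forall w : 'cV[R]_(m + a),
    `|w| <= M * `|velocity_mx x *m w|.
  by near: M.
have xBB : \forall x \near x0, forall y : 'cV[R]_m,
    `|y| <= M * `|B x.1 x.2 *m (B x.1 x.2)^T *m y|.
  by near: M.
near=> x; split.
- split.
  + by near: x.
  + by near: x.
  + by near: x.
- by near: x.
- by near: x.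
Unshelve. all: by end_near. Qed.

End dae.

(** * Estimates along a solution *)

Section trajectory.
Variables (R : realType) (m a : nat).
Local Notation n := (m + a)%N.
Variables (B : 'cV[R]_(m + a) -> R -> 'M[R]_(m, m + a))
          (b : 'cV[R]_(m + a) -> R -> 'cV[R]_m)
          (g : 'cV[R]_(m + a) -> R -> 'cV[R]_a).

Lemma velocity_le M x w : 0 <= M -> local_bound B b g M x ->
  velocity_mx B g x *m w = velocity_rhs b g x -> `|w| <= M * M.
Proof.
move=> M0 [[_ bM gM] VM _] Aw.
apply: le_trans (VM w) _; rewrite ler_wpM2l// Aw.
apply: mx_norm_le => // i j; rewrite ord1; case: (split_ordP i) => [p ->|q ->].
  by rewrite col_mxEu; case: (bM p).
by rewrite col_mxEd mxE normrN; case: (gM q) => _ [_ /(_ None) []].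
Qed.

Variables (v : R -> 'cV[R]_(m + a)) (s h M : R).
Hypotheses (h0 : 0 <= h) (M1 : 1 <= M).
Hypothesis dv : forall u, s <= u <= s + h -> derivable v u 1.
Hypothesis vM : forall u, s <= u <= s + h -> local_bound B b g M (v u, u).
Hypothesis velE : forall u, s <= u <= s + h ->
  velocity_mx B g (v u, u) *m derive1 v u = velocity_rhs b g (v u, u).

Let V := M * M.
Let Lf : R := rate_bound n V M.
Let L : R := M * (Lf + n%:R * Lf * V).
Let T : R := n.+1%:R * (L * M + V * Lf).

Let M0 : 0 <= M. Proof. exact: le_trans M1. Qed.
Let V1 : 1 <= V. Proof. by rewrite mulr_ege1. Qed.
Let V0 : 0 <= V. Proof. exact: le_trans V1. Qed.
Let Lf0 : 0 <= Lf. Proof. exact: rate_bound_ge0. Qed.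
Let L0 : 0 <= L.
Proof. by rewrite mulr_ge0// addr_ge0// !mulr_ge0. Qed.
Let T0 : 0 <= T.
Proof. by rewrite mulr_ge0// addr_ge0// mulr_ge0. Qed.

Let dvV u : s <= u <= s + h -> `|derive1 v u| <= V.
Proof. by move=> us; apply: (velocity_le M0 (vM us)); exact: velE. Qed.

Let ssh : s <= s <= s + h.
Proof. by rewrite lexx lerDl. Qed.

(** From [A v' = c] at two times,
    [A(u) (v'(u) - v'(s)) = (c(u) - c(s)) - (A(u) - A(s)) v'(s)], where [A] and [c]
    are Lipschitz along the curve and [A(u)] has a bounded inverse. *)
Lemma velocity_lipschitz u : s <= u <= s + h ->
  `|derive1 v u - derive1 v s| <= L * (u - s).
Proof.
move=> us; have us0 : 0 <= u - s by rewrite subr_ge0; case/andP: us.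
have [_ Vu _] := vM us.
apply: le_trans (Vu _) _; rewrite /L -mulrA ler_wpM2l//.
set A := velocity_mx B g; set c := velocity_rhs b g.
have -> : A (v u, u) *m (derive1 v u - derive1 v s) =
    (c (v u, u) - c (v s, s)) - (A (v u, u) - A (v s, s)) *m derive1 v s.
  rewrite mulmxBr mulmxBl /A !velE//.
  by rewrite opprB addrA subrK.
rewrite mulrDl; apply: le_trans (ler_normB _ _) _; apply: lerD.
  apply: mx_norm_le => [|i j]; first by rewrite mulr_ge0.
  rewrite ord1 mxE [X in _ + X]mxE /c /velocity_rhs.
  case: (split_ordP i) => [p ->|q ->].
    rewrite !col_mxEu.
    apply: (lipschitz_along V1 dv dvV (f := fun x => b x.1 x.2 p 0)) => //.
    by move=> u' /vM [[_ bM _] _ _]; exact/tame_pred/bM.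
  rewrite !col_mxEd !mxE -opprD normrN.
  apply: (lipschitz_along V1 dv dvV
            (f := 'D_(axis None) (fun x => g x.1 x.2 q 0))) => //.
  move=> u' /vM [[_ _ gM] _ _].
  have [_ [_ dM]] := gM q; exact/tame_pred/dM.
apply: le_trans (mx_norm_mul _ _) _.
rewrite [leRHS]mulrAC; apply: ler_pM => //; [by rewrite mulr_ge0| |exact: dvV].
rewrite -mulrA ler_wpM2l//; apply: mx_norm_le => [|i j]; first by rewrite mulr_ge0.
rewrite mxE [X in _ + X]mxE.
apply: (lipschitz_along V1 dv dvV (f := fun x => A x i j)) => //.
by move=> u' /vM [tM _ _]; exact: (tame_velocity_mx i j tM).
Qed.

Let rate_le f : tame 1 M f (v s, s) -> `|rate f (derive1 v s) (v s, s)| <= Lf.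
Proof.
move=> [_ [_ dM]]; apply: ler_norm_sum_axis => o.
by rewrite normrM ler_pM// ?axis_speed_le ?dvV//; have [] := dM o.
Qed.

Lemma B_velocity u : s <= u <= s + h -> B (v u) u *m derive1 v u = b (v u) u.
Proof.
by move=> us; have := velE us; rewrite mul_col_mx => /eq_col_mx [Bv _].
Qed.

(** The defect minus [(u - s)^2 / 2 alpha], as a function of the end time [u], has
    derivative [b(u) - b(s) - (B(u) - B(s)) v'(u) - (u - s) alpha], because
    [B(u) v'(u) = b(u)].  Expanding [b] and [B] to first order cancels the linear
    terms and leaves [O((u - s)^2)], which the mean value theorem turns into
    [O(h^3)]. *)
Lemma defect_le :
  `|B (v s) s *m (v (s + h) - v s) - h *: b (v s) s
    - (h ^+ 2 / 2) *: alpha B b (derive1 v s) (v s) s|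
  <= (T + n%:R * (T * V + Lf * L)) * h ^+ 3.
Proof.
set C := T + _; have C0 : 0 <= C.
  apply: addr_ge0 => //; apply: mulr_ge0 => //.
  by apply: addr_ge0; apply: mulr_ge0.
apply: mx_norm_le => [|p j]; first by rewrite mulr_ge0// exprn_ge0.
rewrite ord1 {j}.
set w := derive1 v s.
pose c j := B (v s) s p j; pose beta := b (v s) s p 0.
pose al := alpha B b w (v s) s p 0.
(* Up to a constant, the [p]-th component of the difference to be bounded, as a
   function of the end time. *)
pose F : R -> R := (\sum_(j < n) (c j \*: (fun u => v u j 0)))
  - beta \*: id - (al / 2) \*: ((id - cst s) ^+ 2).
have FE u : F u = \sum_(j < n) c j * v u j 0 - beta * u - al / 2 * (u - s) ^+ 2.
  by rewrite /F !fctE /= fct_sumE.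
have -> : (B (v s) s *m (v (s + h) - v s) - h *: b (v s) s
    - (h ^+ 2 / 2) *: alpha B b w (v s) s) p 0 = F (s + h) - F s.
  have subE (x y : 'cV[R]_m) : (x - y) p 0 = x p 0 - y p 0 by rewrite !mxE.
  have scaleE k (x : 'cV[R]_m) : (k *: x) p 0 = k * x p 0 by rewrite mxE.
  rewrite !FE !subE !scaleE -/beta -/al.
  have -> : (B (v s) s *m (v (s + h) - v s)) p 0 =
      \sum_(j < n) c j * v (s + h) j 0 - \sum_(j < n) c j * v s j 0.
    by rewrite mxE -sumrB; apply: eq_bigr => j _; rewrite !mxE mulrBr.
  by field.
have dF u : s <= u <= s + h ->
    is_derive u 1 F (\sum_(j < n) c j * derive1 v u j 0 - beta - al * (u - s)).
  move=> us.
  have dvj j : is_derive u 1 (fun u => v u j 0) (derive1 v u j 0).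
    exact/derivable_coord/dv.
  apply: is_derive_eq; rewrite /= !fctE /GRing.scale /=; by field.
have -> : C * h ^+ 3 = C * h ^+ 2 * (s + h - s) by ring.
apply: (mvt_bound (df := fun u =>
   \sum_(j < n) c j * derive1 v u j 0 - beta - al * (u - s))) => //.
  by rewrite lerDl.
move=> u /andP[/ltW su /ltW uh].
have us : s <= u <= s + h by rewrite su.
have us0 : 0 <= u - s by rewrite subr_ge0.
apply: (@le_trans _ _ (C * (u - s) ^+ 2)); last first.
  by rewrite ler_wpM2l// lerXn2r ?nnegrE// lerBlDl.
have := congr1 (fun x : 'cV_m => x p 0) (B_velocity us).
rewrite mxE => Bvu.
pose rb := rate (fun x => b x.1 x.2 p 0) w (v s, s).
pose rB j := rate (fun x => B x.1 x.2 p j) w (v s, s).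
have -> : \sum_(j < n) c j * derive1 v u j 0 - beta - al * (u - s) =
  (b (v u) u p 0 - beta - (u - s) * rb) -
  \sum_(j < n) ((B (v u) u p j - c j - (u - s) * rB j) * derive1 v u j 0
     + (u - s) * rB j * (derive1 v u j 0 - w j 0)).
  rewrite /al alphaE -/rb -Bvu.
  have -> : \sum_(j < n) ((B (v u) u p j - c j - (u - s) * rB j) *
        derive1 v u j 0 + (u - s) * rB j * (derive1 v u j 0 - w j 0)) =
      \sum_(j < n) B (v u) u p j * derive1 v u j 0 -
      \sum_(j < n) c j * derive1 v u j 0 - (u - s) * \sum_(j < n) rB j * w j 0.
    by rewrite mulr_sumr -!sumrB; apply: eq_bigr => j _; ring.
  by ring.
rewrite /C [leRHS]mulrDl; apply: le_trans (ler_normB _ _) _; apply: lerD.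
  apply: (taylor_along V1 M0 dv dvV L0 velocity_lipschitz
            (f := fun x => b x.1 x.2 p 0)) => //.
  by move=> u' /vM [[_ bM _] _ _]; exact: bM.
have rBL j : `|(u - s) * rB j * (derive1 v u j 0 - w j 0)|
    <= Lf * L * (u - s) ^+ 2.
  have -> : Lf * L * (u - s) ^+ 2 = (u - s) * Lf * (L * (u - s)) by ring.
  have BM := vM ssh; case: BM => -[BM _ _] _ _.
  rewrite normrM (normrM (u - s)) (ger0_norm us0).
  apply: ler_pM; [by rewrite mulr_ge0|by []| |].
    by rewrite ler_wpM2l// rate_le//; exact/tame_pred/BM.
  apply: le_trans (velocity_lipschitz us).
  by have := mx_coord_le (derive1 v u - derive1 v s) j 0; rewrite mxE [X in _ + X]mxE.
rewrite -mulrA -[X in X%:R * _](card_ord n); apply: ler_norm_sum_const => j.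
rewrite [leRHS]mulrDl; apply: le_trans (ler_normD _ _) _; apply: lerD => //.
rewrite normrM [leRHS]mulrAC; apply: ler_pM => //.
  apply: (taylor_along V1 M0 dv dvV L0 velocity_lipschitz
            (f := fun x => B x.1 x.2 p j)) => //.
  by move=> u' /vM [[BM _ _] _ _]; exact: BM.
by apply: le_trans (dvV us); exact: mx_coord_le.
Qed.

End trajectory.

(** * The truncation error of one step *)

Section step.
Variables (R : realType) (m a : nat).
Local Notation X := ('cV[R]_(m + a) * R)%type.
Variables (B : 'cV[R]_(m + a) -> R -> 'M[R]_(m, m + a))
          (b : 'cV[R]_(m + a) -> R -> 'cV[R]_m)
          (g : 'cV[R]_(m + a) -> R -> 'cV[R]_a).

(** The upper block of the Newton system does not involve the current iterate, so
    its solution satisfies the differential rows exactly, for every [d]. *)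
Lemma newton_differential_rows e h v0 vs ts ts' d :
  newton_mx B g e v0 vs ts ts' d \in unitmx ->
  B vs ts *m (newton B b g e h v0 vs ts ts' d - vs) = h *: b vs ts.
Proof.
move=> Nu; rewrite /newton addrC addKr.
have /(congr1 usubmx) := mulKVmx Nu (newton_rhs b g e h v0 vs ts ts' d).
by rewrite mul_col_mx !col_mxKu.
Qed.

Lemma truncation_errorE e h v0 vs ts ts' d v :
  h != 0 -> newton_mx B g e v0 vs ts ts' d \in unitmx -> v ts = vs ->
  truncation_error B b g e h v0 vs ts ts' d v
    - (- (h / 2) *: (pinvB B vs ts *m alpha B b (derive1 v ts) vs ts)) =
  - h^-1 *: (pinvB B vs ts *m
    (B vs ts *m (v (ts + h) - vs) - h *: b vs ts
     - (h ^+ 2 / 2) *: alpha B b (derive1 v ts) vs ts)).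
Proof.
move=> h0 Nu vts; rewrite /truncation_error /projB -mulmxA.
have -> : newton B b g e h v0 vs ts ts' d - v (ts + h) =
    (newton B b g e h v0 vs ts ts' d - vs) - (v (ts + h) - vs).
  by rewrite opprB addrA subrK.
rewrite (mulmxBr (B vs ts)) newton_differential_rows//.
set P := pinvB _ _ _; set y := B vs ts *m _; set al := alpha _ _ _ _ _.
rewrite scaleNr opprK !scalemxAr -mulmxDr; congr (P *m _).
move: y al (b vs ts) => y al bvs.
by apply/colP => k; rewrite !mxE; field.
Qed.

Variable D : set X.

(** The one-step bound at the base point [x].  A single [C] bounds both the error and
    the inverse of the step size, so that uniformity in [x] is one statement about
    large [C]. *)
Definition step_estimate (C : R) (x : X) : Prop :=
  forall (e h t1 t2 ts' : R) (v0 d : 'cV[R]_(m + a)) (v : R -> 'cV[R]_(m + a)),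
  0 < h -> h < C^-1 -> t1 < x.2 -> x.2 + h < t2 ->
  is_solution B b g D `]t1, t2[ v -> v x.2 = x.1 ->
  newton_mx B g e v0 x.1 x.2 ts' d \in unitmx ->
  `| truncation_error B b g e h v0 x.1 x.2 ts' d v
     - (- (h / 2) *: (pinvB B x.1 x.2 *m
                      alpha B b (derive1 v x.2) x.1 x.2)) |
  <= C * h ^+ 2.

Lemma pinvB_le M x (y : 'cV[R]_m) : 0 <= M -> local_bound B b g M x ->
  B x.1 x.2 *m (B x.1 x.2)^T \in unitmx ->
  `|pinvB B x.1 x.2 *m y| <= m%:R * M * (M * `|y|).
Proof.
move=> M0 [[BM _ _] _ BBM] Bu; rewrite /pinvB -mulmxA.
set z := invmx _ *m y.
have zy : `|z| <= M * `|y| by rewrite -[y in leRHS](mulKVmx Bu y); exact: BBM.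
apply: le_trans (mx_norm_mul _ _) _.
apply: ler_pM => //; first by rewrite mulr_ge0.
by apply: ler_wpM2l => //; apply: mx_norm_le => // i p; rewrite mxE; have [] := BM p i.
Qed.

(** On a ball of radius [r] around [x0] the data are bounded; the solutions starting
    in the ball of radius [r / 2] are followed for a time short enough that they
    stay within the larger ball. *)
Lemma near_step_estimate x0 : open D -> smooth_data B b g D ->
  independent_rows B g D -> D x0 ->
  \forall x \near x0 & C \near +oo, step_estimate C x.
Proof.
move=> oD sD rD Dx0.
have [M M1 nM] : exists2 M : R, 1 <= M & \forall x \near x0, local_bound B b g M x.
  have nM := near_local_bound oD sD rD Dx0.
  have n1 : \forall M \near +oo, (1 : R) <= M.
    by apply: nbhs_pinfty_ge; rewrite num_real.
  by have [M [? ?]] := @filter_ex _ _ _ _ (filterI n1 nM); exists M.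
(* [K] is the constant of [defect_le], which depends only on [M] and the dimensions. *)
have [K Kdef] : exists K : R,
    forall (v : R -> 'cV[R]_(m + a)) s h, 0 < h ->
    (forall u, s <= u <= s + h -> derivable v u 1) ->
    (forall u, s <= u <= s + h -> local_bound B b g M (v u, u)) ->
    (forall u, s <= u <= s + h ->
       velocity_mx B g (v u, u) *m derive1 v u = velocity_rhs b g (v u, u)) ->
    `|B (v s) s *m (v (s + h) - v s) - h *: b (v s) s
    - (h ^+ 2 / 2) *: alpha B b (derive1 v s) (v s) s| <= K * h ^+ 3.
  by eexists => v s h h0 dv vM vE; exact: (defect_le (ltW h0) M1 dv vM vE).
have [r /= r0 rM] := (nbhs_ballP _ _).1 nM.
have M0 : 0 <= M by exact: le_trans M1.
pose V := M * M; have V0 : 0 <= V by exact: mulr_ge0.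
have r2 : 0 < r / 2 by rewrite divr_gt0.
have nD : \forall x \near x0, D x by apply: open_nbhs_nbhs.
have nr : \forall x \near x0, ball x0 (r / 2) x by exact: nbhsx_ballx.
have nx : \forall x \near x0, D x /\ ball x0 (r / 2) x by exact: filterI nD nr.
have nC : \forall C \near +oo,
    [/\ 0 < C, (r / 2 / (V + 1))^-1 <= C & m%:R * M * (M * K) <= C].
  near=> C; split; near: C; [apply: nbhs_pinfty_gt|apply: nbhs_pinfty_ge..];
    by rewrite num_real.
exists ([set x | D x /\ ball x0 (r / 2) x],
  [set C | [/\ 0 < C, (r / 2 / (V + 1))^-1 <= C & m%:R * M * (M * K) <= C]]).
  by split; [exact: nx|exact: nC].
move=> [x C] /= [[Dx xr] [C0 hVC KC]] e h t1 t2 ts' v0 d v h0 hC t1s st2 sol vs Nu.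
(* One condition on [h] bounds both [V * h], the motion of the state, and [h]. *)
have hr : (V + 1) * h < r / 2.
  rewrite mulrC -ltr_pdivlMr ?ltr_wpDl//; apply: lt_le_trans hC _.
  rewrite -[leRHS]invrK lef_pV2 ?posrE ?invr_gt0 ?divr_gt0 ?ltr_wpDl//.
have Vh : V * h < r / 2 by apply: le_lt_trans hr; rewrite ler_wpM2r ?lerDl ?ltW.
have hr2 : h < r / 2.
  by apply: le_lt_trans hr; rewrite ler_peMl ?lerDr ?(ltW h0).
set s := x.2 in t1s st2 sol vs Nu *.
have dv u : s <= u <= s + h -> t1 < u < t2.
  by move=> /andP[su ush]; rewrite (lt_le_trans t1s)// (le_lt_trans ush).
have derv u : s <= u <= s + h -> derivable v u 1.
  by move=> /dv ut; have [] := sol u ut.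
have inball u : s <= u <= s + h -> `|v u - v s| < r / 2 ->
    local_bound B b g M (v u, u).
  move=> /andP[su ush] vus; apply: rM.
  rewrite [r]splitr; apply: (ball_triangle xr).
  split; rewrite /= -ball_normE /ball_/=.
    by rewrite -vs distrC.
  by rewrite distrC ger0_norm ?subr_ge0// (le_lt_trans _ hr2)// lerBlDl.
have velE u : s <= u <= s + h -> local_bound B b g M (v u, u) ->
    velocity_mx B g (v u, u) *m derive1 v u = velocity_rhs b g (v u, u).
  by move=> /dv ut [tM _ _]; exact: (solution_velocity sol ut tM).
have close := stays_close V0 Vh derv.
have {}close u : s <= u <= s + h -> `|v u - v s| < r / 2.
  apply: close => {}u us vus; have uM := inball u us vus.
  exact: (velocity_le M0 uM (velE u us uM)).
have vM u : s <= u <= s + h -> local_bound B b g M (v u, u).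
  by move=> us; apply: inball => //; exact: close.
have xM : local_bound B b g M x.
  by rewrite (surjective_pairing x) -vs; apply: vM; rewrite lexx lerDl ltW.
have Bu : B x.1 x.2 *m (B x.1 x.2)^T \in unitmx.
  by apply: row_free_gram_unit; apply: rD; rewrite -surjective_pairing.
rewrite truncation_errorE ?gt_eqF// normrZ normrN normfV (gtr0_norm h0).
rewrite ler_pdivrMl//; apply: le_trans (pinvB_le _ M0 xM Bu) _.
have -> : h * (C * h ^+ 2) = C * h ^+ 3 by ring.
apply: le_trans (ler_wpM2r (exprn_ge0 3 (ltW h0)) KC).
have -> : m%:R * M * (M * K) * h ^+ 3 = m%:R * M * (M * (K * h ^+ 3)) by ring.
apply: ler_wpM2l; first by rewrite mulr_ge0.
apply: ler_wpM2l => //.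
rewrite -{1}vs -/s.
have := Kdef v s h h0 derv vM (fun u us => velE u us (vM u us)).
by rewrite vs.
Unshelve. all: by end_near. Qed.

End step.

(* The O-term is uniform over base points (v^{n[s]}, t^{n[s]}) in a compact
   set, since these vary with the time step when s > 0. *)
Theorem proposition4p1 (R : realType) (m a : nat)
  (B : 'cV[R]_(m + a) -> R -> 'M[R]_(m, m + a))
  (b : 'cV[R]_(m + a) -> R -> 'cV[R]_m)
  (g : 'cV[R]_(m + a) -> R -> 'cV[R]_a)
  (D : set ('cV[R]_(m + a) * R))
  (D_open : open D)
  (data_smooth : smooth_data B b g D)
  (rows_free : independent_rows B g D)
  (S s i : nat) (S_gt0 : (0 < S)%N) (S_le3 : (S <= 3)%N) (s_lt_S : (s < S)%N)
  (K : set ('cV[R]_(m + a) * R)) (K_compact : compact K) (K_sub_D : K `<=` D) :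
  exists C delta : R, 0 < C /\ 0 < delta /\
  forall (h tn : R) (v0 vs d0 : 'cV[R]_(m + a)) (v : R -> 'cV[R]_(m + a))
         (t1 t2 : R),
  let e := rk_eta R S s in
  let ts := subtime S tn h s in
  let ts' := subtime S tn h s.+1 in
  let d := increment B b g e h v0 vs ts ts' d0 i in
  0 < h -> h < delta ->
  K (vs, ts) ->
  t1 < ts -> ts + h < t2 ->
  is_solution B b g D `]t1, t2[ v -> v ts = vs ->
  well_defined_upto B b g D e h v0 vs ts ts' d0 i ->
  `| truncation_error B b g e h v0 vs ts ts' d v
     - (- (h / 2) *: (pinvB B vs ts *m alpha B b (derive1 v ts) vs ts)) |
  <= C * (h^-1 * `| vnext e v0 vs d - vs | ^+ 3 + h ^+ 2).
Proof.
(* A property of large [C] that holds locally near each point of a compact set holds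
   on the whole set. *)
have nK : \forall C \near +oo, K `<=` step_estimate B b g D C.
  apply: ((compact_near_coveringP K).1 K_compact) => x Kx.
  exact: (near_step_estimate D_open data_smooth rows_free (K_sub_D _ Kx)).
have n0 : \forall C \near +oo, (0 : R) < C.
  by apply: nbhs_pinfty_gt; rewrite num_real.
have [C [C0 CK]] := @filter_ex _ _ _ _ (filterI n0 nK).
exists C, C^-1; split=> //; split; first by rewrite invr_gt0.
move=> h tn v0 vs d0 v t1 t2 e ts ts' d h0 hC Kx t1s st2 sol vts wd.
have [_ Nu] := wd i (leqnn i).
apply: le_trans (CK _ Kx e h t1 t2 ts' v0 d v h0 hC t1s st2 sol vts Nu) _.
rewrite ler_wpM2l ?(ltW C0)// lerDr mulr_ge0// ?invr_ge0 ?(ltW h0)//.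
by rewrite exprn_ge0.
Qed.
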